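(* Consider the convex quadratic programming problem $$\min_{x_1\in\mathbb{R}^{d_1},\,x_2\in\mathbb{R}^{d_2}}\ \phi(x_1,x_2)\quad\text{s.t.}\quad A_1x_1+A_2x_2=b$$ (that is, the two-block problem with $\theta_1\equiv0$ and $\theta_2\equiv0$). Then every sequence $\{(x_1^k,x_2^k,\mu^k)\}$ generated by the 2-block proximal ADMM (described in the context) is convergent if and only if $$\begin{bmatrix}H_{11}&0\\0&H_{22}\end{bmatrix}+\begin{bmatrix}A_1^\top A_1&0\\0&A_2^\top A_2\end{bmatrix}+\begin{bmatrix}R_1&0\\0&R_2\end{bmatrix}\succ0 .$$
   Context: Setting: $d=d_1+d_2$, $A_i\in\mathbb{R}^{m\times d_i}$ ($i=1,2$), $b\in\mathbb{R}^m$, $g=(g_1,g_2)\in\mathbb{R}^{d}$, $H=\begin{bmatrix}H_{11}&H_{12}\\H_{12}^\top&H_{22}\end{bmatrix}\in\mathbb{R}^{d\times d}$ is symmetric positive semidefinite with $H_{ij}\in\mathbb{R}^{d_i\times d_j}$, and $$\phi(x_1,x_2)=\tfrac12x_1^\top H_{11}x_1+x_1^\top H_{12}x_2+\tfrac12x_2^\top H_{22}x_2+g_1^\top x_1+g_2^\top x_2 .$$ The problem is assumed to have a KKT point, i.e. a triple $(\bar x_1,\bar x_2,\bar\mu)$ with $\nabla_{x_i}\phi(\bar x_1,\bar x_2)=A_i^\top\bar\mu$ ($i=1,2$) and $A_1\bar x_1+A_2\bar x_2=b$. For a symmetric positive semidefinite $G$, $\|v\|_G^2=v^\top Gv$; $\succ0$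 means positive definite. 2-block proximal ADMM: let $\beta>0$ and let $R_i\in\mathbb{R}^{d_i\times d_i}$ ($i=1,2$) be symmetric positive semidefinite. With $$\mathcal L_\beta(x_1,x_2;\mu)=\phi(x_1,x_2)-\mu^\top(A_1x_1+A_2x_2-b)+\tfrac\beta2\|A_1x_1+A_2x_2-b\|^2,$$ a sequence generated by the method is any sequence, started at any initial $(x_1^0,x_2^0,\mu^0)$, satisfying for all $k\ge0$ $$\begin{aligned} x_1^{k+1}&\in\arg\min_{x_1\in\mathbb{R}^{d_1}}\Big\{\mathcal L_\beta(x_1,x_2^k;\mu^k)+\tfrac12\|x_1-x_1^k\|^2_{R_1}\Big\},\\ x_2^{k+1}&\in\arg\min_{x_2\in\mathbb{R}^{d_2}}\Big\{\mathcal L_\beta(x_1^{k+1},x_2;\mu^k)+\tfrac12\|x_2-x_2^k\|^2_{R_2}\Big\},\\ \mu^{k+1}&=\mu^k-\beta(A_1x_1^{k+1}+A_2x_2^{k+1}-b). \end{aligned}$$ *)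

(* Defs.v *)
From HB Require Import structures.
From mathcomp Require Import all_boot all_order all_algebra.
From mathcomp Require Import all_classical all_reals all_analysis.

Set Implicit Arguments.
Unset Strict Implicit.
Unset Printing Implicit Defensive.

Import Order.TTheory GRing.Theory Num.Theory.
Import numFieldNormedType.Exports.

Local Open Scope classical_set_scope.
Local Open Scope ring_scope.

Section LinearAlgebra.
Variables (R : realType) (n : nat).

Definition dotp (u v : 'cV[R]_n) : R := (u^T *m v) 0 0.

(* The library norm `|v| on matrices is the sup norm; the Euclidean and the
   G-weighted squared norms are therefore written with [dotp]. *)
Definition sqnorm (v : 'cV[R]_n) : R := dotp v v.

Definition wsqnorm (G : 'M[R]_n) (v : 'cV[R]_n) : R := dotp v (G *m v).

Definition posSemidef (G : 'M[R]_n) : Prop :=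
  G^T = G /\ forall v : 'cV[R]_n, 0 <= wsqnorm G v.

Definition posDef (G : 'M[R]_n) : Prop :=
  G^T = G /\ forall v : 'cV[R]_n, v != 0 -> 0 < wsqnorm G v.

Definition gradient (f : 'cV[R]_n -> R) (x : 'cV[R]_n) : 'cV[R]_n :=
  \col_i ('D_(delta_mx i 0) f x : R).

Definition argmin (f : 'cV[R]_n -> R) : set 'cV[R]_n :=
  [set x | forall y, f x <= f y].

End LinearAlgebra.

Section TwoBlockQP.
Variables (R : realType) (m d1 d2 : nat).
Variables (A1 : 'M[R]_(m, d1)) (A2 : 'M[R]_(m, d2)) (b : 'cV[R]_m).
Variables (H11 : 'M[R]_d1) (H12 : 'M[R]_(d1, d2)) (H22 : 'M[R]_d2).
Variables (g1 : 'cV[R]_d1) (g2 : 'cV[R]_d2).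

Definition phi (x1 : 'cV[R]_d1) (x2 : 'cV[R]_d2) : R :=
  2^-1 * dotp x1 (H11 *m x1) + dotp x1 (H12 *m x2)
  + 2^-1 * dotp x2 (H22 *m x2) + dotp g1 x1 + dotp g2 x2.

Definition residual (x1 : 'cV[R]_d1) (x2 : 'cV[R]_d2) : 'cV[R]_m :=
  A1 *m x1 + A2 *m x2 - b.

Definition KKT_point (x1 : 'cV[R]_d1) (x2 : 'cV[R]_d2) (mu : 'cV[R]_m) : Prop :=
  [/\ gradient (fun y1 => phi y1 x2) x1 = A1^T *m mu,
      gradient (fun y2 => phi x1 y2) x2 = A2^T *m mu
    & A1 *m x1 + A2 *m x2 = b].

Variables (R1 : 'M[R]_d1) (R2 : 'M[R]_d2) (beta : R).

Definition augLagrangian (x1 : 'cV[R]_d1) (x2 : 'cV[R]_d2) (mu : 'cV[R]_m) : R :=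
  phi x1 x2 - dotp mu (residual x1 x2) + beta / 2 * sqnorm (residual x1 x2).

Definition proxADMM_sequence (x1 : nat -> 'cV[R]_d1) (x2 : nat -> 'cV[R]_d2)
    (mu : nat -> 'cV[R]_m) : Prop :=
  forall k : nat,
    [/\ argmin (fun y1 => augLagrangian y1 (x2 k) (mu k)
                          + 2^-1 * wsqnorm R1 (y1 - x1 k)) (x1 k.+1),
        argmin (fun y2 => augLagrangian (x1 k.+1) y2 (mu k)
                          + 2^-1 * wsqnorm R2 (y2 - x2 k)) (x2 k.+1)
      & mu k.+1 = mu k - beta *: residual (x1 k.+1) (x2 k.+1)].

End TwoBlockQP.

(* Main.v *)
Require Import Defs.
From HB Require Import structures.
From mathcomp Require Import all_boot all_order all_algebra.
From mathcomp Require Import all_classical all_reals all_analysis.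
From mathcomp Require Import ring lra.

Import Order.TTheory GRing.Theory Num.Theory.
Import numFieldNormedType.Exports.

Local Open Scope classical_set_scope.
Local Open Scope ring_scope.

Set Implicit Arguments.
Unset Strict Implicit.

(** Why the criterion is exact.

Write M for the block-diagonal matrix of the criterion. All its summands are
positive semidefinite, so M is positive definite iff no nonzero pair (v1, v2)
satisfies vi^T Hii vi = 0, Ai vi = 0 and Ri vi = 0.

Necessity. A pair (v1, v2) with these properties is invisible to the method:
semidefiniteness of the whole H kills the off-diagonal block on v1 and on v2
too. Around a KKT point the iterates can therefore oscillate between
xbi + vi and xbi - vi forever ([proxADMM_alternating]), and convergence forces
v1 = 0 and v2 = 0.

Sufficiency. The differences (u, w, nu) between the iterates and a KKT point
follow a homogeneous linear recursion [error_step]. Its energy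
  |w|^2_{H22 + beta A2^T A2 + R2} + |nu|^2 / beta + |u|^2_{R1}
decreases at each step by exactly
  |(u',w')|^2_H + |(u',w)|^2_H + beta |A1 u' + A2 w|^2 + |w'-w|^2_{R2} + |u'-u|^2_{R1}
([energy_balance]). The coupling H12, which has no sign, is absorbed because
both mixed pairs (u',w') and (u',w) are measured by the full matrix H.

The energy does not control u itself. But when M is positive definite, the
matrices Si = Hii + beta Ai^T Ai + Ri of the two subproblems are invertible,
so the energy bounds w and nu, and the first optimality condition expresses u'
through w, nu and R1 u ([error_step_solve]). The errors, from the second one
on, are thus bounded.

To conclude, take limits along an ultrafilter finer than the one at infinity:
every shift of the sequence has a limit, and the limits of the successive
shifts form again an error sequence, along which the energy is constant. An error sequence
that loses no energy has a fixed point of the recursion as its term of index 2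
([conserved_error_fixed]). Subtracting this fixed point gives another error
sequence; its energy converges, and converges to 0 along the ultrafilter,
hence converges to 0. This is convergence of w, nu and, through
[error_step_solve], of u ([error_convergent]). *)

(** * The Euclidean inner product *)

Section InnerProduct.
Context {R : realType}.

Lemma dotpE n (u v : 'cV[R]_n) : dotp u v = \sum_i u i 0 * v i 0.
Proof. by rewrite /dotp mxE; apply: eq_bigr => i _; rewrite mxE. Qed.

Lemma dotpC n (u v : 'cV[R]_n) : dotp u v = dotp v u.
Proof. by rewrite !dotpE; apply: eq_bigr => i _; rewrite mulrC. Qed.

Lemma dotpDr n (u v w : 'cV[R]_n) : dotp u (v + w) = dotp u v + dotp u w.
Proof. by rewrite /dotp mulmxDr mxE. Qed.

Lemma dotpDl n (u v w : 'cV[R]_n) : dotp (u + v) w = dotp u w + dotp v w.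
Proof. by rewrite dotpC dotpDr !(dotpC w). Qed.

Lemma dotpNr n (u v : 'cV[R]_n) : dotp u (- v) = - dotp u v.
Proof. by rewrite /dotp mulmxN mxE. Qed.

Lemma dotpNl n (u v : 'cV[R]_n) : dotp (- u) v = - dotp u v.
Proof. by rewrite dotpC dotpNr dotpC. Qed.

Lemma dotpZr n a (u v : 'cV[R]_n) : dotp u (a *: v) = a * dotp u v.
Proof. by rewrite /dotp -scalemxAr mxE. Qed.

Lemma dotpZl n a (u v : 'cV[R]_n) : dotp (a *: u) v = a * dotp u v.
Proof. by rewrite dotpC dotpZr dotpC. Qed.

Lemma dotp0l n (u : 'cV[R]_n) : dotp 0 u = 0.
Proof. by rewrite /dotp trmx0 mul0mx mxE. Qed.

Lemma dotp0r n (u : 'cV[R]_n) : dotp u 0 = 0.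
Proof. by rewrite dotpC dotp0l. Qed.

Definition dotp_lin := (dotpDl, dotpDr, dotpNl, dotpNr, dotpZl, dotpZr).

Lemma dotp_mulmxr m n (A : 'M[R]_(m, n)) u v :
  dotp u (A *m v) = dotp (A^T *m u) v.
Proof. by rewrite /dotp trmx_mul trmxK mulmxA. Qed.

Lemma dotp_deltar n (u : 'cV[R]_n) i : dotp u (delta_mx i 0) = u i 0.
Proof.
rewrite dotpE (bigD1 i) //= mxE !eqxx mulr1 big1 ?addr0 // => j /negPf jNi.
by rewrite mxE jNi mulr0.
Qed.

Lemma dotp_sum_sqr n (u : 'cV[R]_n) : dotp u u = \sum_i u i 0 ^+ 2.
Proof. by rewrite dotpE; apply: eq_bigr => i _; rewrite expr2. Qed.

Lemma dotp_ge0 n (u : 'cV[R]_n) : 0 <= dotp u u.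
Proof. by rewrite dotp_sum_sqr sumr_ge0 // => i _; rewrite sqr_ge0. Qed.

Lemma dotp_eq0 n (u : 'cV[R]_n) : dotp u u = 0 -> u = 0.
Proof.
rewrite dotp_sum_sqr => /psumr_eq0P u0; apply/matrixP => i j.
rewrite ord1 mxE; apply/eqP; rewrite -sqrf_eq0; apply/eqP/u0 => // k _.
exact: sqr_ge0.
Qed.

Lemma dotp_col_mx m n (u1 v1 : 'cV[R]_m) (u2 v2 : 'cV[R]_n) :
  dotp (col_mx u1 u2) (col_mx v1 v2) = dotp u1 v1 + dotp u2 v2.
Proof. by rewrite /dotp tr_col_mx mul_row_col mxE. Qed.

End InnerProduct.

(** * Positive semidefinite matrices *)

Section Semidefinite.
Context {R : realType}.

Lemma dotp_symmx n (G : 'M[R]_n) u v : G^T = G -> dotp u (G *m v) = dotp v (G *m u).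
Proof. by move=> symG; rewrite dotp_mulmxr symG dotpC. Qed.

Lemma wsqnormD n (G : 'M[R]_n) u v : G^T = G ->
  wsqnorm G (u + v) = wsqnorm G u + 2 * dotp (G *m u) v + wsqnorm G v.
Proof.
move=> symG; rewrite /wsqnorm mulmxDr !dotp_lin (dotp_symmx u v symG).
by rewrite (dotpC (G *m u)); ring.
Qed.

Lemma wsqnormZ n (G : 'M[R]_n) a v : wsqnorm G (a *: v) = a ^+ 2 * wsqnorm G v.
Proof. by rewrite /wsqnorm -scalemxAr !dotp_lin mulrA. Qed.

Lemma posSemidef1 n : posSemidef (1%:M : 'M[R]_n).
Proof. by split=> [|v]; rewrite ?trmx1 // /wsqnorm mul1mx dotp_ge0. Qed.

Lemma posSemidef_CauchySchwarz n (G : 'M[R]_n) u v : posSemidef G ->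
  dotp u (G *m v) ^+ 2 <= wsqnorm G u * wsqnorm G v.
Proof.
move=> [symG G_ge0]; rewrite (dotp_symmx u v symG) dotpC.
set a := wsqnorm G u; set c := wsqnorm G v; set b := dotp _ _.
have quad_ge0 t : 0 <= a + 2 * t * b + t ^+ 2 * c.
  by have := G_ge0 (u + t *: v); rewrite wsqnormD // wsqnormZ dotpZr mulrA.
have [c0|c_neq0] := eqVneq c 0; last first.
  have c_gt0 : 0 < c by rewrite lt_neqAle eq_sym c_neq0 /c G_ge0.
  have := quad_ge0 (- b / c); rewrite -(pmulr_lge0 _ c_gt0).
  suff -> : (a + 2 * (- b / c) * b + (- b / c) ^+ 2 * c) * c = a * c - b ^+ 2.
    by rewrite subr_ge0.
  by field.
(* An affine function of [t] that stays nonnegative has no slope. *)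
have [->|b_neq0] := eqVneq b 0; first by rewrite c0 mulr0 expr0n.
have := quad_ge0 (- (a + 1) / (2 * b)); rewrite c0 mulr0 addr0.
suff -> : a + 2 * (- (a + 1) / (2 * b)) * b = -1 by rewrite ler0N1.
by field.
Qed.

(** Cauchy-Schwarz turns a vanishing quadratic form into a vanishing vector. *)
Lemma posSemidef_ker n (G : 'M[R]_n) v : posSemidef G ->
  wsqnorm G v = 0 -> G *m v = 0.
Proof.
move=> psdG Gv0; apply: dotp_eq0; apply/eqP; rewrite -sqrf_eq0 eq_le sqr_ge0.
by have := posSemidef_CauchySchwarz (G *m v) v psdG; rewrite Gv0 mulr0 => ->.
Qed.

Lemma wsqnorm_block m n (P : 'M[R]_m) (Q : 'M[R]_(m, n)) (S : 'M[R]_n) u v :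
  wsqnorm (block_mx P Q Q^T S) (col_mx u v) =
  wsqnorm P u + 2 * dotp u (Q *m v) + wsqnorm S v.
Proof.
rewrite /wsqnorm mul_block_col dotp_col_mx !dotp_lin.
by rewrite (dotp_mulmxr Q^T) trmxK (dotpC (Q *m v)); ring.
Qed.

Lemma wsqnorm_gram m n (A : 'M[R]_(m, n)) v : wsqnorm (A^T *m A) v = sqnorm (A *m v).
Proof. by rewrite /wsqnorm /sqnorm -mulmxA dotp_mulmxr trmxK. Qed.

Lemma wsqnormDl n (G K : 'M[R]_n) v : wsqnorm (G + K) v = wsqnorm G v + wsqnorm K v.
Proof. by rewrite /wsqnorm mulmxDl dotpDr. Qed.

Lemma wsqnormZl n a (G : 'M[R]_n) v : wsqnorm (a *: G) v = a * wsqnorm G v.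
Proof. by rewrite /wsqnorm -scalemxAl dotpZr. Qed.

Lemma posSemidefD n (G K : 'M[R]_n) : posSemidef G -> posSemidef K -> posSemidef (G + K).
Proof.
move=> [symG G_ge0] [symK K_ge0]; split=> [|v]; first by rewrite linearD /= symG symK.
by rewrite wsqnormDl addr_ge0.
Qed.

Lemma posSemidefZ n a (G : 'M[R]_n) : 0 <= a -> posSemidef G -> posSemidef (a *: G).
Proof.
move=> a_ge0 [symG G_ge0]; split=> [|v]; first by rewrite linearZ /= symG.
by rewrite wsqnormZl mulr_ge0.
Qed.

Lemma posSemidef_gram m n (A : 'M[R]_(m, n)) : posSemidef (A^T *m A).
Proof.
split=> [|v]; first by rewrite trmx_mul trmxK.
by rewrite wsqnorm_gram; exact: dotp_ge0.
Qed.

Lemma unitmx_ker0 n (S : 'M[R]_n) :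
  (forall v : 'cV_n, S *m v = 0 -> v = 0) -> S \in unitmx.
Proof.
move=> kerS; rewrite -unitmx_tr -row_free_unit -kermx_eq0.
apply/eqP/row_matrixP => i; rewrite row0; apply: trmx_inj; rewrite trmx0.
apply: kerS; have /sub_kermxP/(congr1 trmx) := row_sub i (kermx S^T).
by rewrite trmx_mul trmxK trmx0.
Qed.

End Semidefinite.

(** * Convergence of vectors along filters *)

Section Topology.
Context {R : realType}.

Lemma cvg_mxP m n T (F : set_system T) (FF : Filter F)
    (f : T -> 'M[R]_(m, n)) (l : 'M[R]_(m, n)) :
  f @ F --> l <-> forall i j, f x i j @[x --> F] --> l i j.
Proof.
split=> [fl i j|fl]; first exact: (cvg_comp _ _ fl (@coord_continuous R m n i j l)).
move=> A [P nbhsP PA]; rewrite /nbhs /=.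
have : \forall x \near F, forall ij : 'I_m * 'I_n, P ij.1 ij.2 (f x ij.1 ij.2).
  by apply: filter_forall => -[i j]; apply: fl; exact: nbhsP.
by apply: filterS => x Px; apply: PA => i j; exact: (Px (i, j)).
Qed.

Lemma cvg_mulmx m n T (F : set_system T) (FF : Filter F) (A : 'M[R]_(m, n))
    (f : T -> 'cV[R]_n) (l : 'cV[R]_n) :
  f @ F --> l -> A *m f x @[x --> F] --> A *m l.
Proof.
move=> /cvg_mxP fl; apply/cvg_mxP => i j; rewrite mxE.
under eq_fun do rewrite mxE.
apply: cvg_big; first exact: add_continuous.
by move=> k _; apply: cvgMl_tmp; exact: fl.
Qed.

Lemma cvg_dotp n T (F : set_system T) (FF : Filter F)
    (f g : T -> 'cV[R]_n) (u v : 'cV[R]_n) :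
  f @ F --> u -> g @ F --> v -> dotp (f x) (g x) @[x --> F] --> dotp u v.
Proof.
move=> /cvg_mxP fu /cvg_mxP gv; rewrite dotpE.
under eq_fun do rewrite dotpE.
apply: cvg_big; first exact: add_continuous.
by move=> k _; apply: cvgM; [exact: fu | exact: gv].
Qed.

Lemma cvg_wsqnorm n T (F : set_system T) (FF : Filter F) (G : 'M[R]_n)
    (f : T -> 'cV[R]_n) (u : 'cV[R]_n) :
  f @ F --> u -> wsqnorm G (f x) @[x --> F] --> wsqnorm G u.
Proof. by move=> fu; apply: cvg_dotp => //; exact: cvg_mulmx. Qed.

Lemma ultrafilter_bounded_cvg T (U : set_system T) (UU : UltraFilter U)
    (f : T -> R) (M : R) :
  (forall x, `|f x| <= M) -> cvg (f @ U).
Proof.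
move=> f_le; have [|p [_ clp]] := @segment_compact R (- M) M (f @ U) _.
  suff : \forall x \near U, [set` `[-M, M]] (f x) by [].
  by apply: filterE => x /=; rewrite in_itv /= -ler_norml; exact: f_le.
apply/cvg_ex; exists p => N Np /=.
have [//|UN] := in_ultra_setVsetC (f @^-1` N) UU.
by have [y []] := clp (~` N) N UN Np.
Qed.

(** The form itself may have a kernel, in which [v] is free to be unbounded;
only the image [G *m v] is controlled, by Cauchy-Schwarz against the canonical
basis. *)
Lemma ultrafilter_wsqnorm_cvg n T (U : set_system T) (UU : UltraFilter U)
    (G : 'M[R]_n) (v : T -> 'cV[R]_n) (M : R) :
  posSemidef G -> (forall x, wsqnorm G (v x) <= M) ->
  cvg (G *m v x @[x --> U]).
Proof.
move=> psdG v_le.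
have entry_cvg i j : cvg ((G *m v x) i j @[x --> U]).
  apply: (@ultrafilter_bounded_cvg _ _ _ _ (Num.sqrt (wsqnorm G (delta_mx i 0) * M))).
  move=> x; rewrite ord1 -sqrtr_sqr ler_wsqrtr // -dotp_deltar dotpC.
  apply: le_trans (posSemidef_CauchySchwarz _ _ psdG) _.
  by rewrite ler_wpM2l // psdG.2.
apply/cvg_ex; exists (\matrix_(i, j) lim ((G *m v x) i j @[x --> U])).
by apply/cvg_mxP => i j; rewrite mxE; exact: entry_cvg.
Qed.

Lemma wsqnorm_cvg0 n (G : 'M[R]_n) T (F : set_system T) (FF : Filter F)
  (v : T -> 'cV[R]_n) :
  posSemidef G -> wsqnorm G (v x) @[x --> F] --> 0 -> G *m v x @[x --> F] --> (0 : 'cV[R]_n).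
Proof.
move=> psdG v0; apply/cvg_mxP => i j; rewrite mxE ord1.
have bound_cvg0 : Num.sqrt (wsqnorm G (delta_mx i 0) * wsqnorm G (v x)) @[x --> F] --> 0.
  have prod_cvg0 : wsqnorm G (delta_mx i 0) * wsqnorm G (v x) @[x --> F] --> (0 : R).
    by rewrite -[X in _ --> X](mulr0 (wsqnorm G (delta_mx i 0))); exact: cvgMl_tmp.
  by have := cvg_comp _ _ prod_cvg0 (@sqrt_continuous R 0); rewrite sqrtr0.
apply/norm_cvg0P; apply: squeeze_cvgr (cvg_cst 0) bound_cvg0.
apply: nearW => x; rewrite normr_ge0 /= -sqrtr_sqr ler_wsqrtr //.
by rewrite -dotp_deltar dotpC posSemidef_CauchySchwarz.
Qed.

End Topology.

(** * First-order optimality for convex quadratic functions *)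

Section QuadraticOptimality.
Context {R : realType}.

(** An exact second-order expansion at [x]: gradient [q], Hessian [G]. *)
Definition quadratic_at n (f : 'cV[R]_n -> R) (x q : 'cV[R]_n) (G : 'M[R]_n) :=
  forall v, f (x + v) = f x + dotp q v + 2^-1 * wsqnorm G v.

Lemma gradient_quadratic n (f : 'cV[R]_n -> R) x q G :
  quadratic_at f x q G -> gradient f x = q.
Proof.
move=> fq; apply/colP => i; rewrite mxE -dotp_deltar; set e := delta_mx i 0.
apply/cvg_lim => //.
have slope_cvg : dotp q e + h * (2^-1 * wsqnorm G e) @[h --> (0 : R)^'] --> dotp q e.
  rewrite -[X in _ --> X]addr0 -[X in _ --> _ + X](mul0r (2^-1 * wsqnorm G e)).
  apply: cvgD; first exact: cvg_cst.
  by apply: cvgMr_tmp; exact: nbhs_dnbhs.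
apply: cvg_trans slope_cvg; apply: near_eq_cvg.
near=> h; have h_neq0 : h != 0 by near: h; exact: nbhs_dnbhs_neq.
rewrite /= [h *: e + x]addrC fq dotpZr wsqnormZ /GRing.scale /=.
by field.
Unshelve. all: by end_near. Qed.

(** For a semidefinite Hessian the stationary points are the global minimisers. *)
Lemma argmin_quadratic n (f : 'cV[R]_n -> R) x q G : posSemidef G ->
  quadratic_at f x q G -> argmin f x <-> q = 0.
Proof.
move=> [_ G_ge0] fq; split=> [fmin | q0 y]; last first.
  have -> : y = x + (y - x) by rewrite addrC subrK.
  by rewrite fq q0 dotp0l addr0 lerDl mulr_ge0 ?invr_ge0 ?G_ge0.
apply: dotp_eq0; set a := dotp q q; set c := wsqnorm G q.
have c_ge0 : 0 <= c by exact: G_ge0.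
(* The step that minimises a majorant of [f] along the ray of direction [- q]. *)
have := fmin (x + (- (a / (c + 1))) *: q).
rewrite fq dotpZr wsqnormZ -/a -/c -addrA lerDl.
have c1_gt0 : 0 < c + 1 by rewrite ltr_wpDl.
have -> : - (a / (c + 1)) * a + 2^-1 * ((- (a / (c + 1))) ^+ 2 * c) =
          - (a ^+ 2 * ((c / 2 + 1) / (c + 1) ^+ 2)) by field; rewrite gt_eqF.
have c2_gt0 : 0 < (c / 2 + 1) / (c + 1) ^+ 2.
  by rewrite divr_gt0 ?exprn_gt0 // ltr_wpDl // divr_ge0.
rewrite oppr_ge0 pmulr_lle0 // => a2_le0; apply/eqP.
by rewrite -sqrf_eq0 eq_le a2_le0 sqr_ge0.
Qed.

End QuadraticOptimality.

(** * Optimality conditions of the two-block method *)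

Section TwoBlock.
Context {R : realType} {m d1 d2 : nat}.
Variables (A1 : 'M[R]_(m, d1)) (A2 : 'M[R]_(m, d2)) (b : 'cV[R]_m).
Variables (H11 : 'M[R]_d1) (H12 : 'M[R]_(d1, d2)) (H22 : 'M[R]_d2).
Variables (g1 : 'cV[R]_d1) (g2 : 'cV[R]_d2) (beta : R).

(** Exchanging the two blocks lets every fact about the first subproblem serve
for the second one. *)
Lemma phi_swap x1 x2 :
  phi H11 H12 H22 g1 g2 x1 x2 = phi H22 H12^T H11 g2 g1 x2 x1.
Proof. by rewrite /phi (dotp_mulmxr H12^T) trmxK (dotpC (H12 *m x2)); ring. Qed.

Lemma residual_swap x1 x2 : residual A1 A2 b x1 x2 = residual A2 A1 b x2 x1.
Proof. by rewrite /residual (addrC (A1 *m x1)). Qed.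

Lemma augLagrangian_swap x1 x2 mu :
  augLagrangian A1 A2 b H11 H12 H22 g1 g2 beta x1 x2 mu =
  augLagrangian A2 A1 b H22 H12^T H11 g2 g1 beta x2 x1 mu.
Proof. by rewrite /augLagrangian phi_swap residual_swap. Qed.

Definition phi_grad1 (x1 : 'cV[R]_d1) (x2 : 'cV[R]_d2) := H11 *m x1 + H12 *m x2 + g1.

Lemma phi_quadratic1 x1 x2 : H11^T = H11 ->
  quadratic_at (fun y1 => phi H11 H12 H22 g1 g2 y1 x2) x1 (phi_grad1 x1 x2) H11.
Proof.
move=> symH v; rewrite /phi /phi_grad1 -!/(wsqnorm _ _) wsqnormD // !dotp_lin.
by rewrite (dotpC (H12 *m x2)); field.
Qed.

(** The multiplier and the penalty combine into the predicted multiplier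
[mu - beta *: residual]; this is what makes the optimality conditions of the
method look like KKT conditions. *)
Lemma subproblem_quadratic1 (R1 : 'M[R]_d1) (x1 c : 'cV[R]_d1) x2 mu :
  H11^T = H11 -> R1^T = R1 ->
  quadratic_at
    (fun y1 => augLagrangian A1 A2 b H11 H12 H22 g1 g2 beta y1 x2 mu
               + 2^-1 * wsqnorm R1 (y1 - c))
    x1
    (phi_grad1 x1 x2 + R1 *m (x1 - c)
     - A1^T *m (mu - beta *: residual A1 A2 b x1 x2))
    (H11 + beta *: (A1^T *m A1) + R1).
Proof.
move=> symH symR v; rewrite /augLagrangian phi_quadratic1 //.
have -> : residual A1 A2 b (x1 + v) x2 = residual A1 A2 b x1 x2 + A1 *m v.
  by rewrite /residual mulmxDr -!addrA; congr (_ + _); rewrite addrC -!addrA.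
have -> : x1 + v - c = (x1 - c) + v by rewrite addrAC.
move: (residual A1 A2 b x1 x2) => r.
rewrite wsqnormD // !wsqnormDl wsqnormZl wsqnorm_gram /sqnorm !dotp_lin.
rewrite -(dotp_mulmxr A1 (_ - _)) !dotp_lin (dotpC (A1 *m v) r).
by field.
Qed.

Lemma posSemidef_diag1 :
  posSemidef (block_mx H11 H12 H12^T H22) -> posSemidef H11.
Proof.
move=> [symH H_ge0]; split=> [|v].
  by move: symH; rewrite tr_block_mx => /eq_block_mx[].
have := H_ge0 (col_mx v 0).
by rewrite wsqnorm_block mulmx0 dotp0r mulr0 addr0 /wsqnorm mulmx0 dotp0r addr0.
Qed.

Lemma posSemidef_diag2 :
  posSemidef (block_mx H11 H12 H12^T H22) -> posSemidef H22.
Proof.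
move=> [symH H_ge0]; split=> [|v].
  by move: symH; rewrite tr_block_mx => /eq_block_mx[].
have := H_ge0 (col_mx 0 v).
by rewrite wsqnorm_block dotp0l mulr0 addr0 /wsqnorm mulmx0 dotp0r add0r.
Qed.

End TwoBlock.

Section Optimality.
Context {R : realType} {m d1 d2 : nat}.
Variables (A1 : 'M[R]_(m, d1)) (A2 : 'M[R]_(m, d2)) (b : 'cV[R]_m).
Variables (H11 : 'M[R]_d1) (H12 : 'M[R]_(d1, d2)) (H22 : 'M[R]_d2).
Variables (g1 : 'cV[R]_d1) (g2 : 'cV[R]_d2) (beta : R).
Variables (R1 : 'M[R]_d1) (R2 : 'M[R]_d2).
Hypothesis psdH : posSemidef (block_mx H11 H12 H12^T H22).
Hypothesis beta_gt0 : 0 < beta.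
Hypotheses (psdR1 : posSemidef R1) (psdR2 : posSemidef R2).

Let psdH11 : posSemidef H11 := posSemidef_diag1 psdH.
Let psdH22 : posSemidef H22 := posSemidef_diag2 psdH.

Lemma KKT_pointP x1 x2 mu :
  KKT_point A1 A2 b H11 H12 H22 g1 g2 x1 x2 mu <->
  [/\ H11 *m x1 + H12 *m x2 + g1 = A1^T *m mu,
      H22 *m x2 + H12^T *m x1 + g2 = A2^T *m mu
    & A1 *m x1 + A2 *m x2 = b].
Proof.
rewrite /KKT_point (gradient_quadratic (phi_quadratic1 _ _ _ _ _ _ psdH11.1)).
have -> : (fun y2 => phi H11 H12 H22 g1 g2 x1 y2) =
          (fun y2 => phi H22 H12^T H11 g2 g1 y2 x1).
  by apply/funext => y2; rewrite phi_swap.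
by rewrite (gradient_quadratic (phi_quadratic1 _ _ _ _ _ _ psdH22.1)).
Qed.

Lemma posSemidef_subproblem n (G P : 'M[R]_n) (A : 'M[R]_(m, n)) :
  posSemidef G -> posSemidef P -> posSemidef (G + beta *: (A^T *m A) + P).
Proof.
move=> psdG psdP; apply: posSemidefD => //; apply: posSemidefD => //.
by apply: posSemidefZ; [exact: ltW | exact: posSemidef_gram].
Qed.

(** In the second condition the predicted multiplier is the updated [mu k.+1],
whereas in the first one it still involves the old second block. *)
Lemma proxADMM_sequenceP x1 x2 mu :
  proxADMM_sequence A1 A2 b H11 H12 H22 g1 g2 R1 R2 beta x1 x2 mu <->
  forall k,
  [/\ H11 *m x1 k.+1 + H12 *m x2 k + g1 + R1 *m (x1 k.+1 - x1 k) =
      A1^T *m (mu k - beta *: residual A1 A2 b (x1 k.+1) (x2 k)),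
      H22 *m x2 k.+1 + H12^T *m x1 k.+1 + g2 + R2 *m (x2 k.+1 - x2 k) =
      A2^T *m mu k.+1
    & mu k.+1 = mu k - beta *: residual A1 A2 b (x1 k.+1) (x2 k.+1)].
Proof.
suff step k :
    [/\ argmin (fun y1 => augLagrangian A1 A2 b H11 H12 H22 g1 g2 beta y1 (x2 k) (mu k)
                          + 2^-1 * wsqnorm R1 (y1 - x1 k)) (x1 k.+1),
        argmin (fun y2 => augLagrangian A1 A2 b H11 H12 H22 g1 g2 beta (x1 k.+1) y2 (mu k)
                          + 2^-1 * wsqnorm R2 (y2 - x2 k)) (x2 k.+1)
      & mu k.+1 = mu k - beta *: residual A1 A2 b (x1 k.+1) (x2 k.+1)] <->
    [/\ H11 *m x1 k.+1 + H12 *m x2 k + g1 + R1 *m (x1 k.+1 - x1 k) =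
        A1^T *m (mu k - beta *: residual A1 A2 b (x1 k.+1) (x2 k)),
        H22 *m x2 k.+1 + H12^T *m x1 k.+1 + g2 + R2 *m (x2 k.+1 - x2 k) =
        A2^T *m mu k.+1
      & mu k.+1 = mu k - beta *: residual A1 A2 b (x1 k.+1) (x2 k.+1)].
  by split=> seq k; apply/step; exact: seq.
have opt1 := argmin_quadratic (posSemidef_subproblem A1 psdH11 psdR1)
  (subproblem_quadratic1 A1 A2 b H12 H22 g1 g2 beta (x1 k.+1) (x1 k) (x2 k) (mu k)
     psdH11.1 psdR1.1).
have opt2 := argmin_quadratic (posSemidef_subproblem A2 psdH22 psdR2)
  (subproblem_quadratic1 A2 A1 b H12^T H11 g2 g1 beta (x2 k.+1) (x2 k) (x1 k.+1) (mu k)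
     psdH22.1 psdR2.1).
have swap : (fun y2 => augLagrangian A1 A2 b H11 H12 H22 g1 g2 beta (x1 k.+1) y2 (mu k)
                          + 2^-1 * wsqnorm R2 (y2 - x2 k)) =
   (fun y2 => augLagrangian A2 A1 b H22 H12^T H11 g2 g1 beta y2 (x1 k.+1) (mu k)
                          + 2^-1 * wsqnorm R2 (y2 - x2 k)).
  by apply/funext => y2; rewrite augLagrangian_swap.
rewrite swap; split=> -[].
  move=> /opt1/subr0_eq e1 /opt2/subr0_eq e2 e3; split=> //.
  by rewrite e3 residual_swap.
move=> e1 e2 e3; split=> //; first by apply/opt1/eqP; rewrite subr_eq0 -e1.
by apply/opt2/eqP; rewrite subr_eq0 -(residual_swap A1) -e3 -e2.
Qed.

End Optimality.

(** * Dynamics of the error *)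

Section Dynamics.
Context {R : realType} {m d1 d2 : nat}.
Variables (A1 : 'M[R]_(m, d1)) (A2 : 'M[R]_(m, d2)).
Variables (H11 : 'M[R]_d1) (H12 : 'M[R]_(d1, d2)) (H22 : 'M[R]_d2).
Variables (R1 : 'M[R]_d1) (R2 : 'M[R]_d2) (beta : R).
Hypothesis psdH : posSemidef (block_mx H11 H12 H12^T H22).
Hypothesis beta_gt0 : 0 < beta.
Hypotheses (psdR1 : posSemidef R1) (psdR2 : posSemidef R2).

Let H := block_mx H11 H12 H12^T H22.
Let psdH11 : posSemidef H11 := posSemidef_diag1 psdH.
Let psdH22 : posSemidef H22 := posSemidef_diag2 psdH.

(** One iteration, for the differences to a KKT point: the data [b], [g1] and
[g2] cancel and the recursion becomes linear and homogeneous. *)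
Definition error_step (u : 'cV[R]_d1) (w : 'cV[R]_d2) (nu : 'cV[R]_m)
    (u' : 'cV[R]_d1) (w' : 'cV[R]_d2) (nu' : 'cV[R]_m) : Prop :=
  [/\ H11 *m u' + H12 *m w + R1 *m (u' - u) =
      A1^T *m (nu - beta *: (A1 *m u' + A2 *m w)),
      H22 *m w' + H12^T *m u' + R2 *m (w' - w) = A2^T *m nu'
    & nu' = nu - beta *: (A1 *m u' + A2 *m w')].

(** The differences between two KKT points. For such a difference [x], [nu] the
KKT system reads [H x = A^T nu] and [A x = 0]; it yields [x^T H x = 0], so that
[H x] and [A^T nu] vanish separately. *)
Definition error_fixed (u : 'cV[R]_d1) (w : 'cV[R]_d2) (nu : 'cV[R]_m) : Prop :=
  [/\ H11 *m u + H12 *m w = 0, H22 *m w + H12^T *m u = 0, A1^T *m nu = 0,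
      A2^T *m nu = 0 & A1 *m u + A2 *m w = 0].

(** Recentring at another KKT point: both sides of the recursion are linear and
vanish at a fixed point. *)
Lemma error_step_fixed u w nu u' w' nu' a c eta :
  error_step u w nu u' w' nu' -> error_fixed a c eta ->
  error_step (u - a) (w - c) (nu - eta) (u' - a) (w' - c) (nu' - eta).
Proof.
have lin p q n (A : 'M[R]_(n, p)) (B : 'M[R]_(n, q)) s t x y :
    A *m s + B *m t = 0 -> A *m (x - s) + B *m (y - t) = A *m x + B *m y.
  by move=> As_Bt; rewrite !mulmxBr addrACA -opprD As_Bt subr0.
have kill n (A : 'M[R]_(m, n)) x : A^T *m eta = 0 -> A^T *m (x - eta) = A^T *m x.
  by move=> Aeta; rewrite mulmxBr Aeta subr0.
have dif n (x y z : 'cV[R]_n) : x - z - (y - z) = x - y.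
  by rewrite opprB addrA subrK.
move=> [s1 s2 s3] [f1 f2 f3 f4 f5]; split.
- by rewrite !lin // dif s1 (addrAC nu (- eta)) kill.
- by rewrite lin // dif kill.
- by rewrite lin // s3 addrAC.
Qed.

Definition energy (u : 'cV[R]_d1) (w : 'cV[R]_d2) (nu : 'cV[R]_m) : R :=
  wsqnorm (H22 + beta *: (A2^T *m A2) + R2) w + beta^-1 * sqnorm nu + wsqnorm R1 u.

Definition dissipation (u : 'cV[R]_d1) (w : 'cV[R]_d2)
    (u' : 'cV[R]_d1) (w' : 'cV[R]_d2) : R :=
  wsqnorm H (col_mx u' w') + wsqnorm H (col_mx u' w)
  + beta * sqnorm (A1 *m u' + A2 *m w) + wsqnorm R2 (w' - w) + wsqnorm R1 (u' - u).

(** Test the two optimality conditions against [u'] and [w'] and add up. The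
inner product of the multiplier with the residual becomes a difference of
squares by the multiplier update; completing the square merges what is left of
it into [A1 *m u' + A2 *m w], and merges the cross terms in [H12] with the
increment of [w] in the [H22] norm into the two squares in [H]. *)
Lemma energy_balance u w nu u' w' nu' : error_step u w nu u' w' nu' ->
  energy u' w' nu' + dissipation u w u' w' = energy u w nu.
Proof.
move=> [s1 s2 s3].
have {s1} := congr1 (dotp u') s1; have {s2} := congr1 (dotp w') s2.
rewrite !(dotp_mulmxr _^T) !trmxK /energy /dissipation !wsqnorm_block.
rewrite !wsqnormDl !wsqnormZl !wsqnorm_gram s3 /sqnorm /wsqnorm.
rewrite !(mulmxBr, scalerDr, scalerN, dotp_lin) (dotp_mulmxr H12^T) trmxK.
rewrite (dotp_symmx w w' psdR2.1) (dotp_symmx u u' psdR1.1).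
rewrite !(dotpC nu) (dotpC (A2 *m w') (A1 *m u')) (dotpC (A2 *m w) (A1 *m u')).
rewrite (dotpC (H12 *m w')) => e2 e1.
have beta_neq0 : beta != 0 by rewrite gt_eqF.
(* The balance is twice the sum of the two tested optimality conditions. *)
have combine (p q s t x y : R) :
    p = q -> s = t -> x - y = 2 * (p - q) + 2 * (s - t) -> x = y.
  by move=> -> -> /eqP; rewrite !subrr mulr0 addr0 subr_eq0 => /eqP.
by apply: (combine _ _ _ _ _ _ e1 e2); field.
Qed.

Lemma dissipation_ge0 u w u' w' : 0 <= dissipation u w u' w'.
Proof.
rewrite /dissipation !addr_ge0 ?psdH.2 ?psdR1.2 ?psdR2.2 //.
by rewrite mulr_ge0 ?dotp_ge0 // ltW.
Qed.

Lemma block_mul_eq0 (u : 'cV[R]_d1) (w : 'cV[R]_d2) : wsqnorm H (col_mx u w) = 0 ->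
  H11 *m u + H12 *m w = 0 /\ H22 *m w + H12^T *m u = 0.
Proof.
move=> /(posSemidef_ker psdH); rewrite mul_block_col => /eqP.
by rewrite col_mx_eq0 => /andP[/eqP -> /eqP]; rewrite addrC.
Qed.

(** Without loss of energy every square in the dissipation vanishes. Substituted
into the two optimality conditions, this leaves the multiplier terms alone; the
first condition speaks of the old multiplier, the second of the new one. *)
Lemma energy_conserved u w nu u' w' nu' : error_step u w nu u' w' nu' ->
  energy u' w' nu' = energy u w nu ->
  [/\ H11 *m u' + H12 *m w' = 0, H22 *m w' + H12^T *m u' = 0,
      A1^T *m nu = 0 & A2^T *m nu' = 0].
Proof.
move=> step cons; have := energy_balance step; rewrite cons => /eqP.
rewrite addrC -subr_eq0 addrK /dissipation.
have H_ge0 x y : 0 <= wsqnorm H (col_mx x y) by exact: psdH.2.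
have A_ge0 : 0 <= beta * sqnorm (A1 *m u' + A2 *m w).
  by rewrite mulr_ge0 ?dotp_ge0 // ltW.
rewrite !paddr_eq0 ?addr_ge0 ?psdR1.2 ?psdR2.2 //.
move=> /andP[/andP[/andP[/andP[/eqP/block_mul_eq0[Hu' Hw'] /eqP/block_mul_eq0[Hu _]]]]].
rewrite mulf_eq0 gt_eqF //= => /eqP/dotp_eq0 res0.
move=> /eqP/(posSemidef_ker psdR2) dw0 /eqP/(posSemidef_ker psdR1) du0.
case: step => s1 s2 s3; split=> //.
- by rewrite -[nu]subr0 -(scaler0 _ beta) -res0 -s1 Hu du0 addr0.
- by rewrite -s2 Hw' dw0 addr0.
Qed.

(** A vector of the range of [A1 A2] that is orthogonal to this range vanishes. *)
Lemma range_ker_eq0 (u : 'cV[R]_d1) (w : 'cV[R]_d2) :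
  A1^T *m (A1 *m u + A2 *m w) = 0 -> A2^T *m (A1 *m u + A2 *m w) = 0 ->
  A1 *m u + A2 *m w = 0.
Proof.
move=> e1 e2; apply: dotp_eq0.
by rewrite {2}[_ + _]addrC dotpDr 2!dotp_mulmxr e1 e2 !dotp0l addr0.
Qed.

(** Three steps are needed: feasibility at index 2 follows from
[nu 2 = nu 1 - beta * residual] once both [A1^T] and [A2^T] annihilate [nu 1]
and [nu 2]. Step 0 gives [A2^T nu 1 = 0], step 1 gives [A1^T nu 1 = 0] and
[A2^T nu 2 = 0], step 2 gives [A1^T nu 2 = 0]. *)
Lemma conserved_error_fixed u w nu :
  (forall j, error_step (u j) (w j) (nu j) (u j.+1) (w j.+1) (nu j.+1)) ->
  (forall j, energy (u j.+1) (w j.+1) (nu j.+1) = energy (u j) (w j) (nu j)) ->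
  error_fixed (u 2%N) (w 2%N) (nu 2%N).
Proof.
move=> step cons.
have [_ _ _ A2nu1] := energy_conserved (step 0%N) (cons 0%N).
have [Hu Hw A1nu1 A2nu2] := energy_conserved (step 1%N) (cons 1%N).
have [_ _ A1nu2 _] := energy_conserved (step 2%N) (cons 2%N).
have [_ _ nu2] := step 1%N.
have beta_neq0 : beta != 0 by rewrite gt_eqF.
have res_ker n (A : 'M[R]_(m, n)) : A^T *m nu 1%N = 0 -> A^T *m nu 2%N = 0 ->
    A^T *m (A1 *m u 2%N + A2 *m w 2%N) = 0.
  rewrite nu2 mulmxBr -scalemxAr => -> /eqP.
  by rewrite sub0r oppr_eq0 scaler_eq0 (negPf beta_neq0) => /eqP.
by split=> //; apply: range_ker_eq0; exact: res_ker.
Qed.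

(** * Convergence of the error *)

Let S1 := H11 + beta *: (A1^T *m A1) + R1.
Let S2 := H22 + beta *: (A2^T *m A2) + R2.

Let psdS2 : posSemidef S2 := posSemidef_subproblem beta_gt0 A2 psdH22 psdR2.

Lemma energy_bounds u w nu :
  [/\ wsqnorm S2 w <= energy u w nu, wsqnorm 1%:M nu <= beta * energy u w nu
    & wsqnorm R1 u <= energy u w nu].
Proof.
have -> : wsqnorm 1%:M nu = sqnorm nu by rewrite /wsqnorm mul1mx.
rewrite /energy -/S2.
have S2_ge0 := psdS2.2 w; have R1_ge0 := psdR1.2 u.
have nu_ge0 : 0 <= beta^-1 * sqnorm nu by rewrite mulr_ge0 ?dotp_ge0 // invr_ge0 ltW.
split; [lra | | lra].
rewrite !mulrDr mulVKf ?gt_eqF //.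
have := mulr_ge0 (ltW beta_gt0) S2_ge0; have := mulr_ge0 (ltW beta_gt0) R1_ge0.
lra.
Qed.

Lemma energy_ge0 u w nu : 0 <= energy u w nu.
Proof. by have [le_E _ _] := energy_bounds u w nu; apply: le_trans le_E; exact: psdS2.2. Qed.

Hypotheses (unitS1 : S1 \in unitmx) (unitS2 : S2 \in unitmx).

(** The energy sees [u] only through [R1 *m u], and this is all that the first
subproblem remembers of [u]; so [u'] is controlled even though [u] is not. *)
Lemma error_step_solve u w nu u' w' nu' : error_step u w nu u' w' nu' ->
  u' = invmx S1 *m (A1^T *m nu - (H12 + beta *: (A1^T *m A2)) *m w + R1 *m u).
Proof.
move=> [s1 _ _]; rewrite -[LHS](mulKmx unitS1); congr (_ *m _).
have -> : A1^T *m nu = H11 *m u' + H12 *m w + R1 *m (u' - u)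
                       + beta *: (A1^T *m (A1 *m u' + A2 *m w)).
  by rewrite s1 mulmxBr -scalemxAr subrK.
rewrite /S1 !mulmxDl -!scalemxAl -!mulmxA mulmxBr !mulmxDr scalerDr.
rewrite -!(addrA (H11 *m u')) -!addrA; congr (_ + _).
rewrite !opprD !addrA; apply/matrixP => i j; rewrite !mxE; ring.
Qed.

(** The quantities controlled by the energy determine the limits of [w] and of
the next [u']. *)
Lemma error_step_cvg T (F : set_system T) (FF : Filter F) u w nu u' w' nu'
    (r : 'cV[R]_d1) (s : 'cV[R]_d2) (t : 'cV[R]_m) :
  (forall x, error_step (u x) (w x) (nu x) (u' x) (w' x) (nu' x)) ->
  R1 *m u x @[x --> F] --> r -> S2 *m w x @[x --> F] --> s -> nu @ F --> t ->
  w @ F --> invmx S2 *m s /\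
  u' @ F --> invmx S1 *m (A1^T *m t - (H12 + beta *: (A1^T *m A2)) *m (invmx S2 *m s) + r).
Proof.
move=> step ru sw tnu.
have w_cvg : w @ F --> invmx S2 *m s.
  have -> : w = fun x => invmx S2 *m (S2 *m w x) by apply/funext => x; rewrite mulKmx.
  exact: cvg_mulmx.
split=> //.
have -> : u' = fun x => invmx S1 *m (A1^T *m nu x -
    (H12 + beta *: (A1^T *m A2)) *m w x + R1 *m u x).
  by apply/funext => x; exact: error_step_solve (step x).
apply: cvg_mulmx; apply: cvgD => //.
by apply: cvgB; exact: cvg_mulmx.
Qed.

Lemma energy_bounded_cvg T (U : set_system T) (UU : UltraFilter U) u w nu u' w' nu' M :
  (forall x, error_step (u x) (w x) (nu x) (u' x) (w' x) (nu' x)) ->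
  (forall x, energy (u x) (w x) (nu x) <= M) ->
  [/\ cvg (w @ U), cvg (nu @ U) & cvg (u' @ U)].
Proof.
move=> step E_le.
have [b1 b2 b3] : [/\ forall x, wsqnorm S2 (w x) <= M,
    forall x, wsqnorm 1%:M (nu x) <= beta * M & forall x, wsqnorm R1 (u x) <= M].
  split=> x; have [? ? ?] := energy_bounds (u x) (w x) (nu x).
  - exact: le_trans (E_le x).
  - by apply: le_trans (_ : beta * energy (u x) (w x) (nu x) <= _); rewrite ?ler_pM2l.
  - exact: le_trans (E_le x).
have /cvg_ex[s sw] := ultrafilter_wsqnorm_cvg UU psdS2 b1.
have /cvg_ex[r ru] := ultrafilter_wsqnorm_cvg UU psdR1 b3.
have /cvg_ex[t tnu] := ultrafilter_wsqnorm_cvg UU (posSemidef1 m) b2.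
have nu1 : (fun x => 1%:M *m nu x) = nu by apply/funext => x; rewrite mul1mx.
rewrite nu1 in tnu.
have [w_cvg u_cvg] := error_step_cvg _ step ru sw tnu.
by split; apply/cvg_ex; eexists; eassumption.
Qed.

Lemma energy_vanish_cvg T (F : set_system T) (FF : Filter F) u w nu u' w' nu' :
  (forall x, error_step (u x) (w x) (nu x) (u' x) (w' x) (nu' x)) ->
  energy (u x) (w x) (nu x) @[x --> F] --> 0 ->
  [/\ w @ F --> (0 : 'cV_d2), nu @ F --> (0 : 'cV_m) & u' @ F --> (0 : 'cV_d1)].
Proof.
move=> step E0.
have vanish n (G : 'M[R]_n) (v : T -> 'cV[R]_n) k : posSemidef G ->
    (forall x, wsqnorm G (v x) <= k * energy (u x) (w x) (nu x)) ->
    G *m v x @[x --> F] --> (0 : 'cV[R]_n).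
  move=> psdG v_le; apply: wsqnorm_cvg0 => //.
  have kE0 : k * energy (u x) (w x) (nu x) @[x --> F] --> (0 : R).
    by rewrite -[X in _ --> X](mulr0 k); exact: cvgMl_tmp.
  apply: squeeze_cvgr (cvg_cst 0) kE0.
  by apply: nearW => x; rewrite psdG.2 v_le.
have ru : R1 *m u x @[x --> F] --> (0 : 'cV[R]_d1).
  apply: (vanish _ _ _ 1) => // x; rewrite mul1r.
  by have [] := energy_bounds (u x) (w x) (nu x).
have sw : S2 *m w x @[x --> F] --> (0 : 'cV[R]_d2).
  apply: (vanish _ _ _ 1) => // x; rewrite mul1r.
  by have [] := energy_bounds (u x) (w x) (nu x).
have tnu : nu @ F --> (0 : 'cV[R]_m).
  rewrite (_ : nu = fun x => 1%:M *m nu x); last by apply/funext => x; rewrite mul1mx.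
  apply: (vanish _ _ _ beta) => [|x]; first exact: posSemidef1.
  by have [] := energy_bounds (u x) (w x) (nu x).
have [] := error_step_cvg FF step ru sw tnu.
by rewrite !mulmx0 subr0 addr0 mulmx0.
Qed.

Lemma cvg_energy T (F : set_system T) (FF : Filter F) u w nu
    (a : 'cV[R]_d1) (c : 'cV[R]_d2) (eta : 'cV[R]_m) :
  u @ F --> a -> w @ F --> c -> nu @ F --> eta ->
  energy (u x) (w x) (nu x) @[x --> F] --> energy a c eta.
Proof.
move=> ua wc nueta; apply: cvgD; last exact: cvg_wsqnorm.
apply: cvgD; first exact: cvg_wsqnorm.
by apply: cvgMl_tmp; exact: cvg_dotp.
Qed.

Lemma error_step_closed T (F : set_system T) (FF : ProperFilter F)
    u w nu u' w' nu' (a a' : 'cV[R]_d1) (c c' : 'cV[R]_d2) (eta eta' : 'cV[R]_m) :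
  (forall x, error_step (u x) (w x) (nu x) (u' x) (w' x) (nu' x)) ->
  u @ F --> a -> w @ F --> c -> nu @ F --> eta ->
  u' @ F --> a' -> w' @ F --> c' -> nu' @ F --> eta' ->
  error_step a c eta a' c' eta'.
Proof.
move=> step ua wc ne ua' wc' ne'.
have eq_lim n (f g : T -> 'cV[R]_n) (l k : 'cV[R]_n) :
    (forall x, f x = g x) -> f @ F --> l -> g @ F --> k -> l = k.
  by move=> /funext -> fl fk; exact: (cvg_unique _ fl fk).
have sum_cvg : A1 *m u' x + A2 *m w x @[x --> F] --> A1 *m a' + A2 *m c.
  by apply: cvgD; exact: cvg_mulmx.
have res_cvg : A1 *m u' x + A2 *m w' x @[x --> F] --> A1 *m a' + A2 *m c'.
  by apply: cvgD; exact: cvg_mulmx.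
have s1 x : H11 *m u' x + H12 *m w x + R1 *m (u' x - u x) =
    A1^T *m (nu x - beta *: (A1 *m u' x + A2 *m w x)) by case: (step x).
have s2 x : H22 *m w' x + H12^T *m u' x + R2 *m (w' x - w x) = A2^T *m nu' x.
  by case: (step x).
have s3 x : nu' x = nu x - beta *: (A1 *m u' x + A2 *m w' x) by case: (step x).
split.
- apply: (eq_lim _ _ _ _ _ s1).
    apply: cvgD; first by apply: cvgD; exact: cvg_mulmx.
    by apply: cvg_mulmx; exact: cvgB.
  by apply: cvg_mulmx; apply: cvgB => //; exact: cvgZl_tmp.
- apply: (eq_lim _ _ _ _ _ s2).
    apply: cvgD; first by apply: cvgD; exact: cvg_mulmx.
    by apply: cvg_mulmx; exact: cvgB.
  exact: cvg_mulmx.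
- apply: (eq_lim _ _ _ _ _ s3) => //.
  by apply: cvgB => //; exact: cvgZl_tmp.
Qed.

Lemma energy_cvgn u w nu :
  (forall k, error_step (u k) (w k) (nu k) (u k.+1) (w k.+1) (nu k.+1)) ->
  (forall k, energy (u k) (w k) (nu k) <= energy (u 0%N) (w 0%N) (nu 0%N)) /\
  cvg (energy (u k) (w k) (nu k) @[k --> \oo]).
Proof.
move=> step; set E := fun k => energy (u k) (w k) (nu k).
have E_noninc : nonincreasing_seq E.
  apply/nonincreasing_seqP => k; rewrite /E -(energy_balance (step k)) lerDl.
  exact: dissipation_ge0.
split=> [k|]; first exact: (E_noninc 0%N k).
apply: nonincreasing_is_cvgn => //.
by exists 0 => _ [k _ <-]; exact: energy_ge0.
Qed.

(** A LaSalle argument. The limits of several consecutive iterates are needed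
together, and an ultrafilter provides them all at once without successive
extractions of subsequences. *)
Lemma error_convergent u w nu :
  (forall k, error_step (u k) (w k) (nu k) (u k.+1) (w k.+1) (nu k.+1)) ->
  exists (a : 'cV[R]_d1) (c : 'cV[R]_d2) (eta : 'cV[R]_m),
    [/\ u @ \oo --> a, w @ \oo --> c & nu @ \oo --> eta].
Proof.
move=> step; have [E_le /cvg_ex[/= e E_cvg]] := energy_cvgn step.
have [U [UU ooU]] := ultraFilterLemma eventually_filter.
(* The shift by one: [u k.+1] is bounded through the recursion, but nothing
   bounds [u k] in terms of the iterate of index [k]. *)
have shifted_cvg j : [/\ cvg (w (j + k).+1 @[k --> U]), cvg (nu (j + k).+1 @[k --> U])
    & cvg (u (j + k).+1 @[k --> U])].
  have [_ _ ucv] := energy_bounded_cvg UU (fun k => step (j + k)%N) (fun k => E_le _).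
  by have [] := energy_bounded_cvg UU (fun k => step (j + k).+1) (fun k => E_le _).
pose p j := lim (u (j + k).+1 @[k --> U]).
pose q j := lim (w (j + k).+1 @[k --> U]).
pose s j := lim (nu (j + k).+1 @[k --> U]).
have pP j : u (j + k).+1 @[k --> U] --> p j by have [] := shifted_cvg j.
have qP j : w (j + k).+1 @[k --> U] --> q j by have [] := shifted_cvg j.
have sP j : nu (j + k).+1 @[k --> U] --> s j by have [] := shifted_cvg j.
have limit_step j : error_step (p j) (q j) (s j) (p j.+1) (q j.+1) (s j.+1).
  exact: (error_step_closed _ (fun k => step (j + k).+1) (pP j) (qP j) (sP j)
    (pP j.+1) (qP j.+1) (sP j.+1)).
have along_U j (f : nat -> R) (l : R) : f @ \oo --> l -> f (j + k).+1 @[k --> U] --> l.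
  move=> fl; apply: cvg_trans (cvg_comp _ _ (cvg_addnl j.+1) fl).
  by move=> A; exact: ooU.
have limit_energy j : energy (p j) (q j) (s j) = e.
  have E_cvg_U : energy (u (j + k).+1) (w (j + k).+1) (nu (j + k).+1) @[k --> U]
      --> energy (p j) (q j) (s j) by exact: cvg_energy.
  exact: (cvg_unique _ E_cvg_U (along_U j _ _ E_cvg)).
have fixed : error_fixed (p 2%N) (q 2%N) (s 2%N).
  by apply: conserved_error_fixed => // j; rewrite !limit_energy.
exists (p 2%N), (q 2%N), (s 2%N).
have dstep k := error_step_fixed (step k) fixed.
have [_ /cvg_ex[/= e' D_cvg]] := energy_cvgn dstep.
(* The energy relative to the limit point converges; its limit is read off along [U]. *)
have e'_eq0 : e' = 0.
  have p_cvg : u (2 + k)%N.+1 - p 2%N @[k --> U] --> (0 : 'cV[R]_d1).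
    by apply/subr_cvg0.
  have q_cvg : w (2 + k)%N.+1 - q 2%N @[k --> U] --> (0 : 'cV[R]_d2).
    by apply/subr_cvg0.
  have s_cvg : nu (2 + k)%N.+1 - s 2%N @[k --> U] --> (0 : 'cV[R]_m).
    by apply/subr_cvg0.
  have D_cvg_U := cvg_energy (@ultra_proper _ U UU) p_cvg q_cvg s_cvg.
  have energy0 : energy 0 0 0 = 0.
    by rewrite /energy /wsqnorm /sqnorm !dotp0l mulr0 !addr0.
  by rewrite energy0 in D_cvg_U; exact: (cvg_unique _ (along_U 2%N _ _ D_cvg) D_cvg_U).
rewrite e'_eq0 in D_cvg.
have [w_cvg nu_cvg u_cvg] := energy_vanish_cvg _ dstep D_cvg.
have recentre n (x : nat -> 'cV[R]_n) (l : 'cV[R]_n) :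
    x k - l @[k --> \oo] --> (0 : 'cV[R]_n) -> x @ \oo --> l.
  by move=> /subr_cvg0.
(* [u_cvg] is about the next iterate, hence the shift. *)
split; [| exact: recentre | exact: recentre].
by have /recentre := u_cvg; rewrite (cvg_shiftS u).
Qed.

End Dynamics.

(** * The criterion *)

Section Criterion.
Context {R : realType} {m d1 d2 : nat}.
Variables (A1 : 'M[R]_(m, d1)) (A2 : 'M[R]_(m, d2)) (b : 'cV[R]_m).
Variables (H11 : 'M[R]_d1) (H12 : 'M[R]_(d1, d2)) (H22 : 'M[R]_d2).
Variables (g1 : 'cV[R]_d1) (g2 : 'cV[R]_d2).
Variables (R1 : 'M[R]_d1) (R2 : 'M[R]_d2) (beta : R).
Hypothesis psdH : posSemidef (block_mx H11 H12 H12^T H22).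
Hypothesis beta_gt0 : 0 < beta.
Hypotheses (psdR1 : posSemidef R1) (psdR2 : posSemidef R2).

Let psdH11 : posSemidef H11 := posSemidef_diag1 psdH.
Let psdH22 : posSemidef H22 := posSemidef_diag2 psdH.

Let M := block_mx H11 0 0 H22 + block_mx (A1^T *m A1) 0 0 (A2^T *m A2)
         + block_mx R1 0 0 R2.

Lemma wsqnorm_block_diag (P : 'M[R]_d1) (S : 'M[R]_d2) u v :
  wsqnorm (block_mx P 0 0 S) (col_mx u v) = wsqnorm P u + wsqnorm S v.
Proof.
by have := wsqnorm_block P 0 S u v; rewrite trmx0 mul0mx dotp0r mulr0 addr0.
Qed.

Lemma wsqnorm_criterion u v : wsqnorm M (col_mx u v) =
  (wsqnorm H11 u + sqnorm (A1 *m u) + wsqnorm R1 u)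
  + (wsqnorm H22 v + sqnorm (A2 *m v) + wsqnorm R2 v).
Proof.
by rewrite !wsqnormDl !wsqnorm_block_diag !wsqnorm_gram; ring.
Qed.

(** The criterion has weight 1 in front of the Gram matrix and the subproblem
has weight [beta]; only the common kernel of the three summands matters. *)
Lemma subproblem_unitmx n (G P : 'M[R]_n) (A : 'M[R]_(m, n)) :
  posSemidef G -> posSemidef P ->
  (forall v, v != 0 -> 0 < wsqnorm G v + sqnorm (A *m v) + wsqnorm P v) ->
  G + beta *: (A^T *m A) + P \in unitmx.
Proof.
move=> psdG psdP pd; apply: unitmx_ker0 => v Sv0.
have := congr1 (dotp v) Sv0; rewrite dotp0r -/(wsqnorm _ v).
rewrite !wsqnormDl wsqnormZl wsqnorm_gram => /eqP.
have A_ge0 : 0 <= beta * sqnorm (A *m v) by rewrite mulr_ge0 ?dotp_ge0 // ltW.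
rewrite !paddr_eq0 ?addr_ge0 ?psdG.2 ?psdP.2 // mulf_eq0 (gt_eqF beta_gt0) /=.
move=> /andP[/andP[/eqP G0 /eqP A0] /eqP P0]; apply/eqP; apply: contraT => /pd.
by rewrite G0 A0 P0 !addr0 ltxx.
Qed.

Lemma proxADMM_error_step x1 x2 mu xb1 xb2 mub :
  KKT_point A1 A2 b H11 H12 H22 g1 g2 xb1 xb2 mub ->
  proxADMM_sequence A1 A2 b H11 H12 H22 g1 g2 R1 R2 beta x1 x2 mu ->
  forall k, error_step A1 A2 H11 H12 H22 R1 R2 beta
    (x1 k - xb1) (x2 k - xb2) (mu k - mub)
    (x1 k.+1 - xb1) (x2 k.+1 - xb2) (mu k.+1 - mub).
Proof.
move=> /(KKT_pointP _ _ _ _ _ psdH)[k1 k2 k3].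
move=> /(proxADMM_sequenceP _ _ _ _ _ psdH beta_gt0 psdR1 psdR2) seq k.
have [s1 s2 s3] := seq k.
have resE y1 y2 : A1 *m (y1 - xb1) + A2 *m (y2 - xb2) = residual A1 A2 b y1 y2.
  by rewrite /residual -k3 !mulmxBr addrACA -opprD.
have shift n (x y z : 'cV[R]_n) : x - z - (y - z) = x - y.
  by rewrite opprB addrA subrK.
have centre n (X Y P W Z g : 'cV[R]_n) :
    X - W + (Y - Z) + P = X + Y + g + P - (W + Z + g).
  by apply/matrixP => i j; rewrite !mxE; ring.
split; rewrite ?resE ?shift.
- rewrite [mu k - mub - _]addrAC (mulmxBr A1^T) -s1 -k1 (mulmxBr H11) (mulmxBr H12).
  exact: centre.
- by rewrite (mulmxBr A2^T) -s2 -k2 (mulmxBr H22) (mulmxBr H12^T); exact: centre.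
- by rewrite s3 addrAC.
Qed.

(** Consecutive terms differ by [2 *: v] up to sign; squaring the entries removes
the sign. *)
Lemma alternating_cvg_eq0 n (x v l : 'cV[R]_n) :
  x + (-1) ^+ k *: v @[k --> \oo] --> l -> v = 0.
Proof.
move=> /cvg_mxP x_cvg; apply/matrixP => i j; rewrite mxE.
have {x_cvg} := x_cvg i j; set f := fun k => _ => f_cvg.
have f'_cvg : f k.+1 @[k --> \oo] --> l i j by rewrite (cvg_shiftS f).
have jump : (f k.+1 - f k) ^+ 2 @[k --> \oo] --> ((l i j - l i j) ^+ 2 : R).
  by rewrite expr2; under eq_fun do rewrite expr2; apply: cvgM; exact: cvgB.
have jumpE : (fun k => (f k.+1 - f k) ^+ 2) = fun=> (2 * v i j) ^+ 2.
  apply/funext => k; rewrite /f !mxE (exprS (-1)).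
  transitivity (((-1) ^+ k) ^+ 2 * (2 * v i j) ^+ 2); first ring.
  by rewrite sqrr_sign mul1r.
have /eqP : (2 * v i j) ^+ 2 = (l i j - l i j) ^+ 2.
  by rewrite jumpE in jump; exact: (cvg_unique _ (cvg_cst _) jump).
by rewrite subrr expr0n /= sqrf_eq0 mulf_eq0 pnatr_eq0 /= => /eqP.
Qed.

(** A direction in the kernel of the criterion is invisible to both subproblems.
That [H12] vanishes on it too is a consequence of the semidefiniteness of the
full Hessian, applied to [(v1, 0)] and to [(0, v2)]. *)
Lemma proxADMM_alternating xb1 xb2 mub v1 v2 :
  KKT_point A1 A2 b H11 H12 H22 g1 g2 xb1 xb2 mub ->
  wsqnorm M (col_mx v1 v2) = 0 ->
  proxADMM_sequence A1 A2 b H11 H12 H22 g1 g2 R1 R2 beta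
    (fun k => xb1 + (-1) ^+ k *: v1) (fun k => xb2 + (-1) ^+ k *: v2) (fun=> mub).
Proof.
move=> /(KKT_pointP _ _ _ _ _ psdH)[k1 k2 k3].
rewrite wsqnorm_criterion => /eqP.
rewrite !paddr_eq0 ?addr_ge0 ?dotp_ge0 ?psdH11.2 ?psdH22.2 ?psdR1.2 ?psdR2.2 //.
move=> /andP[/andP[/andP[/eqP Hv1 /eqP/dotp_eq0 Av1] /eqP/(posSemidef_ker psdR1) Rv1]].
move=> /andP[/andP[/eqP Hv2 /eqP/dotp_eq0 Av2] /eqP/(posSemidef_ker psdR2) Rv2].
have [H11v1 H12v1] : H11 *m v1 = 0 /\ H12^T *m v1 = 0.
  have : wsqnorm (block_mx H11 H12 H12^T H22) (col_mx v1 0) = 0.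
    by rewrite wsqnorm_block Hv1 mulmx0 dotp0r mulr0 /wsqnorm mulmx0 dotp0r !addr0.
  move=> /(posSemidef_ker psdH)/eqP.
  by rewrite mul_block_col !mulmx0 !addr0 col_mx_eq0 => /andP[/eqP ? /eqP ?].
have [H12v2 H22v2] : H12 *m v2 = 0 /\ H22 *m v2 = 0.
  have : wsqnorm (block_mx H11 H12 H12^T H22) (col_mx 0 v2) = 0.
    by rewrite wsqnorm_block Hv2 dotp0l mulr0 /wsqnorm mulmx0 dotp0r !addr0.
  move=> /(posSemidef_ker psdH)/eqP.
  by rewrite mul_block_col !mulmx0 !add0r col_mx_eq0 => /andP[/eqP ? /eqP ?].
have ignore n p (G : 'M[R]_(n, p)) x v k : G *m v = 0 ->
    G *m (x + (-1) ^+ k *: v) = G *m x.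
  by move=> Gv; rewrite mulmxDr -scalemxAr Gv scaler0 addr0.
have res0 j k : residual A1 A2 b (xb1 + (-1) ^+ j *: v1) (xb2 + (-1) ^+ k *: v2) = 0.
  by rewrite /residual !ignore // k3 subrr.
apply/(proxADMM_sequenceP _ _ _ _ _ psdH beta_gt0 psdR1 psdR2) => k.
rewrite !res0 !scaler0 !subr0 !ignore // !mulmxBr !ignore // !subrr !addr0.
by split.
Qed.

End Criterion.

Lemma cvg_triple_components (X Y Z : topologicalType) T (F : set_system T)
    (FF : Filter F) (x : T -> X) (y : T -> Y) (z : T -> Z) (a : X) (b : Y) (c : Z) :
  (x t, y t, z t) @[t --> F] --> (a, b, c) -> x @ F --> a /\ y @ F --> b.
Proof.
move=> xyz_cvg.
have xy_cvg : (x t, y t) @[t --> F] --> (a, b) :=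
  cvg_comp _ _ xyz_cvg (cvg_fst (FG := nbhs_filter c)).
have x_cvg : x @ F --> a := cvg_comp _ _ xy_cvg (cvg_fst (FG := nbhs_filter b)).
by have y_cvg : y @ F --> b := cvg_comp _ _ xy_cvg (cvg_snd (FF := nbhs_filter a)).
Qed.

Theorem corollary1 (R : realType) (m d1 d2 : nat)
  (A1 : 'M[R]_(m, d1)) (A2 : 'M[R]_(m, d2)) (b : 'cV[R]_m)
  (H11 : 'M[R]_d1) (H12 : 'M[R]_(d1, d2)) (H22 : 'M[R]_d2)
  (g1 : 'cV[R]_d1) (g2 : 'cV[R]_d2)
  (R1 : 'M[R]_d1) (R2 : 'M[R]_d2) (beta : R)
  (psdH : posSemidef (block_mx H11 H12 H12^T H22))
  (kkt : exists (x1 : 'cV[R]_d1) (x2 : 'cV[R]_d2) (mu : 'cV[R]_m),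
      KKT_point A1 A2 b H11 H12 H22 g1 g2 x1 x2 mu)
  (beta_gt0 : 0 < beta)
  (psdR1 : posSemidef R1) (psdR2 : posSemidef R2) :
  (forall (x1 : nat -> 'cV[R]_d1) (x2 : nat -> 'cV[R]_d2) (mu : nat -> 'cV[R]_m),
      proxADMM_sequence A1 A2 b H11 H12 H22 g1 g2 R1 R2 beta x1 x2 mu ->
      exists (x1' : 'cV[R]_d1) (x2' : 'cV[R]_d2) (mu' : 'cV[R]_m),
        (x1 k, x2 k, mu k) @[k --> \oo] --> (x1', x2', mu'))
  <->
  posDef (block_mx H11 0 0 H22
          + block_mx (A1^T *m A1) 0 0 (A2^T *m A2)
          + block_mx R1 0 0 R2).
Proof.
have psdH11 := posSemidef_diag1 psdH; have psdH22 := posSemidef_diag2 psdH.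
have [xb1 [xb2 [mub opt]]] := kkt.
split=> [all_cvg | [_ pd] x1 x2 mu seq].
  split=> [|v].
    rewrite !linearD /= !tr_block_mx !trmx_mul !trmxK !trmx0.
    by rewrite psdH11.1 psdH22.1 psdR1.1 psdR2.1.
  rewrite -[v]vsubmxK; set v1 := usubmx v; set v2 := dsubmx v => v_neq0.
  rewrite lt_neqAle; apply/andP; split; last first.
    rewrite wsqnorm_criterion.
    by rewrite !addr_ge0 ?dotp_ge0 ?psdH11.2 ?psdH22.2 ?psdR1.2 ?psdR2.2.
  apply: contra v_neq0 => /eqP/esym Mv0.
  have := proxADMM_alternating psdH beta_gt0 psdR1 psdR2 opt Mv0.
  move=> /all_cvg[l1 [l2 [l3]]] /cvg_triple_components[].
  by move=> /alternating_cvg_eq0 -> /alternating_cvg_eq0 ->; rewrite col_mx0.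
have unit1 : H11 + beta *: (A1^T *m A1) + R1 \in unitmx.
  apply: subproblem_unitmx => // v v_neq0.
  have := pd (col_mx v 0); rewrite col_mx_eq0 (negPf v_neq0) => /(_ isT).
  by rewrite wsqnorm_criterion /wsqnorm /sqnorm !(mulmx0, dotp0r) !addr0.
have unit2 : H22 + beta *: (A2^T *m A2) + R2 \in unitmx.
  apply: subproblem_unitmx => // v v_neq0.
  have := pd (col_mx 0 v); rewrite col_mx_eq0 (negPf v_neq0) andbF => /(_ isT).
  by rewrite wsqnorm_criterion /wsqnorm /sqnorm !(mulmx0, dotp0r) !add0r.
have [a [c [eta [ua wc nueta]]]] := error_convergent psdH beta_gt0 psdR1 psdR2
  unit1 unit2 (proxADMM_error_step psdH beta_gt0 psdR1 psdR2 opt seq).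
have uncentre n (x : nat -> 'cV[R]_n) (xb l : 'cV[R]_n) :
    x k - xb @[k --> \oo] --> l -> x @ \oo --> l + xb.
  move=> xl; rewrite (_ : x = fun k => (x k - xb) + xb); last first.
    by apply/funext => k; rewrite subrK.
  by apply: cvgD => //; exact: cvg_cst.
exists (a + xb1), (c + xb2), (eta + mub).
exact: (cvg_pair (cvg_pair (uncentre _ _ _ _ ua) (uncentre _ _ _ _ wc))
  (uncentre _ _ _ _ nueta)).
Qed.
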